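(* Let $d\ge 1$ and $0\le k\le d+1$. Then $$Q_{d,k}(x)=\begin{cases}2\sum_{\pi\in NC(d)} wt_k(\pi) & \text{if } 1\le k\le d,\\ \sum_{\pi\in NC(d)} wt_k(\pi) & \text{if } k=0 \text{ or } k=d+1.\end{cases}$$
   Context: For $j\ge 0$ let $g(L_j,x)=\sum_{m=0}^{\lfloor j/2\rfloor}\frac{1}{j-m+1}\binom{j}{m}\binom{2j-2m}{j}(x-1)^m$. Define $Q_{d,0}(x)=(x-1)^{d+1}+\sum_{j=0}^{d}2^{d-j}\binom{d}{j}(x-1)^{d-j}g(L_j,x)$; for $1\le k\le d$, $Q_{d,k}(x)=\sum_{j=k-1}^{d}2^{d-j}\left[\binom{d-k}{d-j}+\binom{d+1-k}{d-j}\right](x-1)^{d-j}g(L_j,x)$; and $Q_{d,d+1}(x)=g(L_d,x)$. $NC(d)$ is the set of noncrossing partitions of $[1,d]$. For $\pi\in NC(d)$: an element is a singleton if it forms a block by itself; $\mathrm{block}(\pi)$ is the number of blocks of size at least $2$; $k\in[1,d]$ is an antisingleton if $k$ and $k+1$ lie in the same block, with $d+1$ read as $1$. Intervals: for $1\le k\le l\le d$, $[k,l]=\{k,\dots,l\}$ (not wrapped); $[1,d]^*$ denotes the whole set $[1,d]$ regarded as a wrapped interval. For a family $\mathcal S$ of pairwise disjoint intervals: a singleton is in $\mathcal S$ if it lies in an interval of $\mathcal S$; an antisingleton $k\le d-1$ is in $\mathcal S$ if $\{k,k+1\}$ lies in a single interval of $\mathcal S$; the antisingleton $d$ is in $\mathcal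 S$ iff $\mathcal S$ contains a wrapped interval. Set $wt_{\mathcal S}(\pi)=x^{\mathrm{block}(\pi)+s+a}$, where $s$ (resp. $a$) is the number of singletons (resp. antisingletons) of $\pi$ in $\mathcal S$. Finally $wt_k(\pi)=wt_{\{[k,d]\}}(\pi)$ for $1\le k\le d$, $wt_0(\pi)=wt_{\{[1,d]^*\}}(\pi)$, and $wt_{d+1}(\pi)=wt_{\emptyset}(\pi)=x^{\mathrm{block}(\pi)}$. *)

(* Defs.v *)
From HB Require Import structures.
From mathcomp Require Import all_boot all_order all_algebra.

Set Implicit Arguments.
Unset Strict Implicit.
Unset Printing Implicit Defensive.

Import GRing.Theory.
Local Open Scope ring_scope.

Definition gL (j : nat) : {poly rat} :=
  \sum_(0 <= m < (j./2).+1)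
    ((j - m + 1)%:R^-1 * 'C(j, m)%:R * 'C(2 * j - 2 * m, j)%:R)
      *: ('X - 1) ^+ m.

(* Only meaningful for k <= d.+1; every k > d falls in the last branch. *)
Definition Q (d k : nat) : {poly rat} :=
  if k == 0%N then
    ('X - 1) ^+ d.+1
    + \sum_(0 <= j < d.+1)
        (2 ^ (d - j) * 'C(d, j))%:R *: (('X - 1) ^+ (d - j) * gL j)
  else if (k <= d)%N then
    \sum_(k.-1 <= j < d.+1)
      (2 ^ (d - j) * ('C(d - k, d - j) + 'C(d + 1 - k, d - j)))%:R
        *: (('X - 1) ^+ (d - j) * gL j)
  else gL d.

(* The ground set [1, d] is encoded as 'I_d; the ordinal i stands for i.+1. *)

Definition noncrossing (d : nat) (pi : {set {set 'I_d}}) : bool :=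
  [forall B in pi, forall B' in pi,
   forall a : 'I_d, forall b : 'I_d, forall c : 'I_d, forall e : 'I_d,
     [&& (a < b)%N, (b < c)%N, (c < e)%N,
         a \in B, c \in B, b \in B' & e \in B'] ==> (B == B')].

Definition NC (d : nat) : {set {set {set 'I_d}}} :=
  [set pi | partition pi [set: 'I_d] & noncrossing pi].

Definition nblock (d : nat) (pi : {set {set 'I_d}}) : nat :=
  #|[set B in pi | (2 <= #|B|)%N]|.

Definition singleton (d : nat) (pi : {set {set 'I_d}}) (i : 'I_d) : bool :=
  [set i] \in pi.

(* ordS is the cyclic successor, so the last element is compared with the
   first; when d = 1 the unique element is both a singleton and an
   antisingleton. *)
Definition antisingleton (d : nat) (pi : {set {set 'I_d}}) (i : 'I_d) : bool :=
  [exists B in pi, (i \in B) && (ordS i \in B)].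

(* [Segment k l] is the unwrapped interval [k, l], with 1-based endpoints;
   [Wrapped] is [1, d]^*. *)
Inductive nc_interval := Segment of nat & nat | Wrapped.

Definition is_wrapped (I : nc_interval) : bool :=
  if I is Wrapped then true else false.

Definition in_interval (d : nat) (I : nc_interval) (i : 'I_d) : bool :=
  if I is Segment k l then (k <= i.+1 <= l)%N else true.

Definition singleton_in (d : nat) (S : seq nc_interval) (pi : {set {set 'I_d}})
    (i : 'I_d) : bool :=
  singleton pi i && has (fun I => in_interval I i) S.

Definition antisingleton_in (d : nat) (S : seq nc_interval)
    (pi : {set {set 'I_d}}) (i : 'I_d) : bool :=
  antisingleton pi i &&
  (if (i.+1 < d)%N then
     has (fun I => in_interval I i && in_interval I (ordS i)) S
   else has is_wrapped S).

Definition wt (d : nat) (S : seq nc_interval) (pi : {set {set 'I_d}}) :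
    {poly rat} :=
  'X ^+ (nblock pi + #|[set i | singleton_in S pi i]|
                   + #|[set i | antisingleton_in S pi i]|).

Definition wt_family (d k : nat) : seq nc_interval :=
  if k == 0%N then [:: Wrapped]
  else if (k <= d)%N then [:: Segment k d]
  else [::].

Definition wtk (d k : nat) (pi : {set {set 'I_d}}) : {poly rat} :=
  wt (wt_family d k) pi.

(* Main.v *)
(* Write t = x - 1 and F(d,k) for the sum of wt_k over NC(d). Compare wt_k with
   wt_(k+1): they differ by a factor x when k is a singleton or an antisingleton
   (for k < d it cannot be both), so sum wt_k = sum wt_(k+1) + t * (sum over k
   singleton) + t * (sum over k antisingleton). Deleting k maps both restricted
   sums bijectively onto the weighted sum over NC(d-1) with the same index k; in
   the second case, if {k, k+1} is a block, the block that is lost is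
   compensated by the new singleton, which is weighted. This gives F(d,k) =
   F(d,k+1) + 2t F(d-1,k), which is Pascal's rule on the side of Q / 2.
   Contracting d into 1 relates k = 0 and k = 1 in the same way.

   There remains k = d+1, where gL is identified with the generating polynomial
   G_d of the number of big blocks.  Splitting at the predecessor of the last
   element in its block gives
     G_(d+1) = sum_(i+j=d) G_i G_j + t * sum_(i+j=d-1) G_i G_j,
   i.e. G = 1 + (z + t z^2) G^2 for the generating series G of the G_d in z, so
   G = sum_n Cat_n (z + t z^2)^n, whose coefficients are the gL. *)

Require Import Defs.
From mathcomp Require Import all_boot all_order all_algebra.
From mathcomp Require Import ring zify.

Set Implicit Arguments.
Unset Strict Implicit.
Unset Printing Implicit Defensive.

Import GRing.Theory Num.Theory.
Local Open Scope ring_scope.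

(** * Catalan numbers and the polynomials gL *)

Definition catalan (n : nat) : rat := 'C(2 * n, n)%:R / n.+1%:R.

Lemma catalan0 : catalan 0 = 1.
Proof. by rewrite /catalan bin0 divr1. Qed.

(** The step from ['C(2 * n, n)] to ['C(2 * n.+1, n.+1)] goes through ['C((2 * n).+1, n)]. *)
Lemma catalanS n : n.+2%:R * catalan n.+1 = (4 * n + 2)%:R * catalan n.
Proof.
have h : (n.+1 * 'C(2 * n.+1, n.+1) = (4 * n + 2) * 'C(2 * n, n))%N.
  have e1 := mul_bin_diag (2 * n).+2 n.
  have e2 := mul_bin_down (2 * n).+1 n.
  have -> : (2 * n.+1 = (2 * n).+2)%N by lia.
  rewrite /= in e1 e2; rewrite -e1.
  have -> : ((2 * n).+2 = 2 * ((2 * n).+1 - n))%N by lia.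
  rewrite -mulnA -e2; lia.
have n1 : n.+1%:R != 0 :> rat by rewrite pnatr_eq0.
have n2 : n.+2%:R != 0 :> rat by rewrite pnatr_eq0.
rewrite /catalan mulrC divfK //.
apply: (mulfI n1); rewrite -natrM h natrM; field.
by rewrite -(natrD _ 1).
Qed.

(* With S_n the right-hand side and T_n its variant weighted by i, symmetry gives
   2 T_n = n S_n, and [catalanS] gives (T + S)_(n+1) = Cat_(n+1) + 4 T_n + 2 S_n. *)
Lemma catalan_conv n : catalan n.+1 = \sum_(i < n.+1) catalan i * catalan (n - i).
Proof.
pose S n := \sum_(i < n.+1) catalan i * catalan (n - i).
pose T n := \sum_(i < n.+1) i%:R * (catalan i * catalan (n - i)).
have TS m : 2%:R * T m = m%:R * S m.
  rewrite mulr_natl mulr2n {1}/T (reindex_inj rev_ord_inj) /= -big_split /= /S mulr_sumr.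
  apply: eq_bigr => i _.
  rewrite subSS subKn; last by rewrite -ltnS.
  have -> : m%:R = (m - i)%:R + i%:R :> rat by rewrite -natrD subnK // -ltnS.
  by ring.
rewrite -/(S n); elim: n => [|n IH].
  rewrite /S big_ord1 catalan0 mulr1.
  have := catalanS 0; rewrite catalan0 mulr1 => h.
  by apply: (@mulfI _ 2%:R) => //; rewrite h mulr1.
have e1 : T n.+1 + S n.+1 = catalan n.+1 + 4%:R * T n + 2%:R * S n.
  rewrite /T /S -big_split /= big_ord_recl /= subn0 mul0r add0r catalan0 mul1r.
  rewrite -addrA; congr (_ + _).
  rewrite !mulr_sumr -big_split /=; apply: eq_bigr => i _.
  rewrite /bump leq0n add1n subSS.
  rewrite -[X in _ + X]mul1r -mulrDl -(natrD _ i.+1 1) addn1 mulrA catalanS.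
  rewrite natrD natrM; ring.
have n3 : n.+3%:R != 0 :> rat by rewrite pnatr_eq0.
apply: (mulfI n3); rewrite catalanS.
have := congr1 (fun u => 2%:R * u) e1.
rewrite !mulrDr TS (mulrCA _ 4%:R) TS -IH => e2.
have -> : n.+3%:R = n.+1%:R + 2%:R :> rat by rewrite -natrD addn2.
rewrite mulrDl e2; move: (catalan n.+1) => c.
ring.
Qed.

(** With n = d - m, both ['C(d, m) * 'C(2 * n, d)] and ['C(2 * n, n) * 'C(n, m)] equal (2n)! / (m!
    n! (n - m)!). *)
Lemma gLE d : gL d = \sum_(n < d.+1) (catalan n * 'C(n, d - n)%:R) *: ('X - 1) ^+ (d - n).
Proof.
rewrite /gL big_mkord.
rewrite [RHS](reindex_inj rev_ord_inj) /=.
rewrite (big_ord_widen d.+1 (fun m : nat =>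
  ((d - m + 1)%:R^-1 * 'C(d, m)%:R * 'C(2 * d - 2 * m, d)%:R) *: ('X - 1) ^+ m
    : {poly rat})); last by lia.
rewrite big_mkcond /=; apply: eq_bigr => m _.
have md : (m <= d)%N by rewrite -ltnS.
rewrite subSS (subKn md).
case: ifP => hm; last first.
  (* Past [d./2] the factor ['C(d - m, m)] vanishes, so the sum may run up to d. *)
  rewrite (@bin_small (d - m)) ?mulr0 ?scale0r //; lia.
congr (_ *: _); rewrite /catalan addn1 -mulrA mulrC [RHS]mulrAC.
have mm : (m <= d - m)%N by lia.
have -> : (2 * d - 2 * m = 2 * (d - m))%N by lia.
congr (_ / _); rewrite -!natrM; congr _%:R.
have b1 := bin_fact md; have b2 := bin_fact mm.
have l1 : (d - m <= 2 * (d - m))%N by lia.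
have l2 : (d <= 2 * (d - m))%N by lia.
have b3 := bin_fact l1; have b4 := bin_fact l2.
have e1 : (2 * (d - m) - (d - m) = d - m)%N by lia.
have e2 : (2 * (d - m) - d = d - m - m)%N by lia.
rewrite e1 in b3; rewrite e2 in b4.
have fp : (0 < m`! * (d - m)`! * (d - m - m)`!)%N by rewrite !muln_gt0 !fact_gt0.
apply/eqP; rewrite -(eqn_pmul2l fp); apply/eqP.
transitivity ((2 * (d - m))`!)%N.
  rewrite -b4 -b1; ring.
rewrite -b3 -{2}b2; ring.
Qed.

(** * The generating series of the gL *)

Local Notation t := ('X - 1 : {poly rat}).

(* An element of Q[x][z]: the inner 'X, inside t, is x, the outer one is z. *)
Definition catalan_arg : {poly {poly rat}} := 'X * (1 + t *: 'X).

(** Truncation keeps the series a polynomial. Since [catalan_arg ^+ n] is divisible by z^n, the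
    coefficient of z^d is final once d < N. *)
Definition catalan_series N := \sum_(n < N) (catalan n)%:P%:P * catalan_arg ^+ n.

Lemma coef_catalan_argX n d :
  (catalan_arg ^+ n)`_d = if (n <= d)%N then 'C(n, d - n)%:R *: t ^+ (d - n) else 0.
Proof.
rewrite /catalan_arg exprMn coefXnM ltnNge; case: leqP => //= nd.
rewrite addrC exprD1n coef_sum.
under eq_bigr => i _ do rewrite exprZn coefMn coefZ coefXn.
have [h|h] := ltnP (d - n) n.+1.
  rewrite (bigD1 (Ordinal h)) //= eqxx big1 ?addr0.
    by rewrite mulr1 scaler_nat.
  move=> i hi; case: eqP => [e|_]; last by rewrite mulr0 mul0rn.
  by case/eqP: hi; apply: val_inj.
rewrite big1 ?bin_small ?scale0r // => i _.
case: eqP => [e|_]; last by rewrite mulr0 mul0rn.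
by have := ltn_ord i; rewrite -e ltnNge h.
Qed.

Lemma coef_catalan_series N d : (d < N)%N -> (catalan_series N)`_d = gL d.
Proof.
move=> dN; rewrite gLE /catalan_series coef_sum.
rewrite (big_ord_widen N (fun n : nat => (catalan n * 'C(n, d - n)%:R) *: t ^+ (d - n))) //.
rewrite [RHS]big_mkcond; apply: eq_bigr => n _.
rewrite coefCM coef_catalan_argX ltnS; case: ifP => _; last by rewrite mulr0.
by rewrite mul_polyC scalerA.
Qed.

(** Coefficient of z^(d+1) in G = 1 + (z + t z^2) G^2. Truncations satisfy this equation in low
    degrees only, hence the bounds [e <= d] below. For d = 0 the second sum is empty, so the default
    value of [d.-1] is harmless. *)
Lemma gL_rec d :
  gL d.+1 = \sum_(i < d.+1) gL i * gL (d - i) + t * \sum_(i < d) gL i * gL (d.-1 - i).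
Proof.
have sqP e : (e <= d)%N -> (catalan_series d.+1 ^+ 2)`_e = \sum_(i < e.+1) gL i * gL (e - i).
  move=> ed; rewrite expr2 coefM; apply: eq_bigr => i _.
  have := ltn_ord i => hi; rewrite !coef_catalan_series //; lia.
have PS : catalan_series d.+2 = 1 + catalan_arg *
    \sum_(n < d.+1) (catalan n.+1)%:P%:P * catalan_arg ^+ n.
  rewrite /catalan_series big_ord_recl catalan0 expr0 mulr1 mulr_sumr.
  congr (_ + _); apply: eq_bigr => i _.
  by rewrite /= /bump add1n exprS mulrCA.
(* [catalan_arg] is divisible by z, so degree e + 1 of a product with it sees only degrees up to e
   of the other factor. *)
have coef_low (p q : {poly {poly rat}}) e :
    (forall i, (i <= e)%N -> p`_i = q`_i) -> (catalan_arg * p)`_e.+1 = (catalan_arg * q)`_e.+1.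
  move=> h; rewrite /catalan_arg -!mulrA !coefXM /= !coefM; apply: eq_bigr => i _.
  by rewrite h // leq_subr.
pose R := \sum_(n < d.+1) (catalan n.+1)%:P%:P * catalan_arg ^+ n.
have sqR e : (e <= d)%N -> (catalan_series d.+1 ^+ 2)`_e = R`_e.
  move=> ed; have y0 n : (e < n)%N -> (catalan_arg ^+ n)`_e = 0.
    by rewrite coef_catalan_argX ltnNge; case: ifP.
  rewrite expr2 /catalan_series mulr_suml /R !coef_sum.
  (* The contribution of the pair (i, n - i) to degree e; the double sum is regrouped along n = i +
     j, so that [catalan_conv] applies. *)
  pose h i n := (catalan i)%:P * (catalan (n - i))%:P * (catalan_arg ^+ n)`_e.
  transitivity (\sum_(i < d.+1) \sum_(n < d.+1 | (i <= n)%N) h i n).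
    apply: eq_bigr => i _; rewrite mulr_sumr coef_sum.
    rewrite -(big_mkord xpredT (fun j => (_ * ((catalan j)%:P%:P * catalan_arg ^+ j))`_e)).
    (* The pairs with i + j > d contribute nothing in degree e <= d. *)
    have di : (d.+1 - i <= d.+1)%N by exact: leq_subr.
    rewrite (@big_cat_nat _ _ _ (d.+1 - i)) //= [X in _ + X]big1_seq => [|j].
      rewrite addr0 -(big_mkord (fun n => (i <= n)%N) (h i)).
      rewrite [RHS](@big_cat_nat _ _ _ i) //=; last exact: ltnW (ltn_ord i).
      have -> : \sum_(0 <= n < i | (i <= n)%N) h i n = 0.
        by rewrite big_nat_cond big_pred0 // => n; apply/negP; lia.
      rewrite add0r -[X in index_iota X d.+1]add0n big_addn; apply: eq_big => j.
        by rewrite leq_addl.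
      move=> _; rewrite /h addnK mulrACA -exprD.
      by rewrite -(polyCM (catalan i)%:P) coefCM addnC.
    rewrite mem_index_iota => /andP[_ /andP[h1 h2]].
    by rewrite mulrACA -exprD -(polyCM (catalan i)%:P) coefCM y0 ?mulr0 //; lia.
  rewrite (exchange_big_dep xpredT) //=; apply: eq_bigr => n _.
  rewrite catalan_conv coefCM rmorph_sum mulr_suml.
  have nd : (n.+1 <= d.+1)%N by exact: ltn_ord.
  rewrite -(big_ord_widen _ (h^~ n) nd); apply: eq_bigr => i _.
  by rewrite /h -polyCM.
have := @coef_catalan_series d.+2 d.+1 (ltnSn _) => <-.
rewrite PS coefD coef1 add0r -/R -(coef_low (catalan_series d.+1 ^+ 2)); last exact: sqR.
rewrite /catalan_arg -mulrA coefXM /= mulrDl mul1r coefD sqP //; congr (_ + _).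
rewrite -scalerAl coefZ coefXM; case: d sqP {PS coef_low R sqR} => [|d] sqP.
  by rewrite big_ord0.
by rewrite sqP.
Qed.

Lemma gL0 : gL 0 = 1.
Proof. by rewrite gLE big_ord1 catalan0 mul1r expr0 scale1r. Qed.

(** * Recurrences for Q *)

(** The sums defining [Q], reversed by i = d - j, with the upper index of the binomial freed from d:
    Pascal's rule then acts on n alone. *)
Definition gLbin (d n : nat) : {poly rat} :=
  \sum_(i < d.+1) (2 ^ i * 'C(n, i))%:R *: (t ^+ i * gL (d - i)).

Lemma gLbin0 d : gLbin d 0 = gL d.
Proof.
rewrite /gLbin big_ord_recl /= bin0 scale1r mul1r subn0 big1 ?addr0 // => i _.
by rewrite /bump /= bin0n muln0 scale0r.
Qed.

Lemma gLbinS d n : gLbin d.+1 n.+1 = gLbin d.+1 n + 2%:R * t * gLbin d n.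
Proof.
rewrite /gLbin [LHS]big_ord_recl [in RHS]big_ord_recl /= !bin0 -addrA.
congr (_ + _); rewrite mulr_sumr -big_split; apply: eq_bigr => i _ /=.
rewrite /bump /= add1n binS mulnDr natrD scalerDl subSS; congr (_ + _).
rewrite expnS -mulnA mulnC natrM -scalerA -scalerAr; congr (_ *: _).
rewrite scaler_nat exprS; ring.
Qed.

Lemma Q_gLbin d k : (0 < k <= d)%N -> Q d k = gLbin d (d - k) + gLbin d (d.+1 - k).
Proof.
case/andP=> k0 kd; rewrite /Q eqn0Ngt k0 kd /= /gLbin -big_split /=.
pose f j := (2 ^ (d - j) * ('C(d - k, d - j) + 'C(d + 1 - k, d - j)))%:R
  *: (t ^+ (d - j) * gL j).
(* For j < k - 1 both binomials vanish, since d - j > d + 1 - k. *)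
have -> : \sum_(k.-1 <= j < d.+1) f j = \sum_(0 <= j < d.+1) f j.
  rewrite [RHS](@big_cat_nat _ _ _ k.-1) //=; last by lia.
  suff -> : \sum_(0 <= j < k.-1) f j = 0 by rewrite add0r.
  rewrite big1_seq // => j; rewrite mem_index_iota /f => /andP[_ hj].
  by rewrite !bin_small ?muln0 ?scale0r //; lia.
rewrite big_mkord [LHS](reindex_inj rev_ord_inj) /=; apply: eq_bigr => i _.
have id : (i <= d)%N by rewrite -ltnS.
by rewrite /f subSS subKn // addn1 mulnDr natrD scalerDl.
Qed.

Lemma Q0_gLbin d : Q d 0 = t ^+ d.+1 + gLbin d d.
Proof.
rewrite /Q /gLbin eqxx big_mkord; congr (_ + _).
rewrite [RHS](reindex_inj rev_ord_inj) /=; apply: eq_bigr => j _.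
have jd : (j <= d)%N by rewrite -ltnS.
by rewrite subSS subKn // bin_sub.
Qed.

Lemma Q_rec d k : (0 < k <= d)%N -> Q d.+1 k = Q d.+1 k.+1 + 2%:R * t * Q d k.
Proof.
case/andP=> k0 kd; rewrite !Q_gLbin ?k0 ?kd ?ltnS //; last by rewrite ltnW.
rewrite !subSS !subSn // ?(leqW kd) // !gLbinS; ring.
Qed.

(** This starts the descent on k: [Q d.+1 d.+2] is [gL d.+1], without the factor 2, so the pattern
    of [Q_rec] breaks here. *)
Lemma Q_diag d : Q d.+1 d.+1 = 2%:R * (gL d.+1 + t * gL d).
Proof.
rewrite Q_gLbin ?ltnSn // subnn subSnn gLbinS !gLbin0; ring.
Qed.

Lemma Q0_rec d : (0 < d)%N -> 2%:R * Q d.+1 0 = Q d.+1 1 + 2%:R * t * Q d 0.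
Proof.
move=> d0; rewrite !Q0_gLbin Q_gLbin // !subSS !subn0 gLbinS exprS; ring.
Qed.

(** * Noncrossing equivalence relations *)

(* A partition is encoded by the matrix of its equivalence relation; the second
   clause (right Euclidean) gives symmetry and transitivity in view of the first. *)
Definition ncrel d (r : 'M[bool]_d) : bool :=
  [&& [forall a, r a a],
      [forall a, forall b, forall c, r a b && r a c ==> r b c] &
      [forall a : 'I_d, forall b : 'I_d, forall c : 'I_d, forall e : 'I_d,
         [&& (a < b)%N, (b < c)%N, (c < e)%N, r a c & r b e] ==> r a b]].

Lemma ncrelP d (r : 'M[bool]_d) :
  reflect [/\ forall a, r a a, forall a b, r a b = r b a,
              forall b a c, r a b -> r b c -> r a c &
              forall a b c e : 'I_d, (a < b)%N -> (b < c)%N -> (c < e)%N ->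
                r a c -> r b e -> r a b] (ncrel r).
Proof.
apply: (iffP and3P) => [[/forallP r1 r2 r3]|[r1 r2 r3 r4]].
  have eucl a b c : r a b -> r a c -> r b c.
    move=> h1 h2; move/forallP/(_ a)/forallP/(_ b)/forallP/(_ c)/implyP: r2.
    by apply; rewrite h1.
  have sy a b : r a b -> r b a by move=> h; apply: (eucl a).
  split=> //.
  - by move=> a b; apply/idP/idP; apply: sy.
  - by move=> b a c h; apply: eucl; apply: sy.
  - move=> a b c e h1 h2 h3 h4 h5.
    move/forallP/(_ a)/forallP/(_ b)/forallP/(_ c)/forallP/(_ e)/implyP: r3.
    by apply; rewrite h1 h2 h3 h4.
split; first exact/forallP.
- apply/forallP=> a; apply/forallP=> b; apply/forallP=> c; apply/implyP=> /andP[h1 h2].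
  by apply: (r3 a) => //; rewrite r2.
- apply/forallP=> a; apply/forallP=> b; apply/forallP=> c; apply/forallP=> e.
  by apply/implyP=> /and5P[h1 h2 h3 h4 h5]; apply: (r4 a b c e).
Qed.

Definition sing d (r : 'M[bool]_d) (i : 'I_d) : bool := [forall j, r i j ==> (j == i)].
Definition anti d (r : 'M[bool]_d) (i : 'I_d) : bool := r i (ordS i).

Lemma singP d (r : 'M[bool]_d) i : reflect (forall j, r i j -> j = i) (sing r i).
Proof.
apply: (iffP forallP) => h j.
  by move=> hj; apply/eqP; apply: (implyP (h j)).
by apply/implyP=> /h ->.
Qed.

Definition is_first d (r : 'M[bool]_d) (i : 'I_d) : bool := [forall j, r i j ==> (i <= j)%N].
Definition is_last d (r : 'M[bool]_d) (i : 'I_d) : bool := [forall j, r i j ==> (j <= i)%N].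

Lemma is_firstP d (r : 'M[bool]_d) i : reflect (forall j, r i j -> (i <= j)%N) (is_first r i).
Proof. by apply: (iffP forallP) => h j; apply/implyP; apply: h. Qed.
Lemma is_lastP d (r : 'M[bool]_d) i : reflect (forall j, r i j -> (j <= i)%N) (is_last r i).
Proof. by apply: (iffP forallP) => h j; apply/implyP; apply: h. Qed.

(* Non-singleton blocks are counted by their first elements; [nbig_last] counts them
   by their last ones.  When contracting i into another element of its block, the
   convenient count is the one in which i does not contribute. *)
Definition nbig d (r : 'M[bool]_d) : nat := \sum_i (is_first r i && ~~ sing r i).

(* The exponent of wt_k for 1 <= k <= d.+1; for k = d.+1 both sums are empty. *)
Definition wexp d k (r : 'M[bool]_d) : nat :=
  (nbig r + \sum_(i < d) ((k <= i.+1) && sing r i)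
   + \sum_(i < d) [&& (k <= i.+1), (i.+1 < d) & anti r i])%N.
Definition wexp0 d (r : 'M[bool]_d) : nat :=
  (nbig r + \sum_(i < d) sing r i + \sum_(i < d) anti r i)%N.

Definition cls d (r : 'M[bool]_d) (i : 'I_d) : {set 'I_d} := [set j | r i j].
Definition classes d (r : 'M[bool]_d) : {set {set 'I_d}} := [set cls r i | i : 'I_d].

Section Classes.
Variables (d : nat) (r : 'M[bool]_d).
Hypothesis hr : ncrel r.

Lemma cls_eq i j : r i j -> cls r i = cls r j.
Proof.
case/ncrelP: hr => r1 r2 r3 _ h; apply/setP=> x; rewrite !inE.
by apply/idP/idP => h'; [apply: (r3 i) => //; rewrite r2 | apply: (r3 j)].
Qed.

Lemma sing_card i : sing r i = ~~ (2 <= #|cls r i|)%N.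
Proof.
case/ncrelP: hr => r1 _ _ _.
apply/singP/negP => [h /card_gt1P [x [y []]]|h j hj].
  by rewrite !inE => /h -> /h ->; rewrite eqxx.
apply/eqP/negPn/negP => ji; apply: h; apply/card_gt1P.
by exists j, i; rewrite !inE hj r1.
Qed.

(** [P] selects one representative in each class. First elements and last elements are the two
    choices used. *)
Lemma card_big_classes (P : pred 'I_d) :
    (forall i, exists2 j, r i j & P j) ->
    (forall i j, r i j -> P i -> P j -> i = j) ->
  #|[set B in classes r | (2 <= #|B|)%N]| = (\sum_i (P i && ~~ sing r i))%N.
Proof.
move=> exP uniqP; case/ncrelP: hr => r1 r2 r3 _.
have -> : [set B in classes r | (2 <= #|B|)%N] = cls r @: [set i | P i && ~~ sing r i].
  apply/setP=> B; rewrite !inE; apply/andP/imsetP => [[/imsetP[i _ ->] h]|[i]].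
    have [j hj Pj] := exP i; exists j; last exact: cls_eq.
    by rewrite inE Pj sing_card negbK -(cls_eq hj).
  by rewrite inE sing_card negbK => /andP[_ h] ->; split=> //; apply: imset_f.
rewrite card_in_imset -?sum1_card ?big_mkcond /=.
  by apply: eq_bigr => i _; rewrite inE; case: ifP.
move=> i j; rewrite !inE => /andP[Pi _] /andP[Pj _] /setP/(_ j).
by rewrite !inE r1 => h; apply: uniqP.
Qed.

Lemma nbigE : #|[set B in classes r | (2 <= #|B|)%N]| = nbig r.
Proof.
case/ncrelP: hr => r1 r2 r3 _; apply: card_big_classes.
  move=> i; pose P := [pred j | r i j].
  have Pi : P i by rewrite inE.
  case: (arg_minnP (fun j : 'I_d => j : nat) Pi) => j hj jmin.
  by exists j => //; apply/is_firstP => k hk; apply: jmin; apply: (r3 j).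
move=> i j h /is_firstP h1 /is_firstP h2; apply/val_inj/eqP.
by rewrite eqn_leq h1 // h2 // r2.
Qed.

Lemma nbig_last : nbig r = (\sum_i (is_last r i && ~~ sing r i))%N.
Proof.
case/ncrelP: hr => r1 r2 r3 _; rewrite -nbigE; apply: card_big_classes.
  move=> i; pose P := [pred j | r i j].
  have Pi : P i by rewrite inE.
  case: (arg_maxnP (fun j : 'I_d => j : nat) Pi) => j hj jmax.
  by exists j => //; apply/is_lastP => k hk; apply: jmax; apply: (r3 j).
move=> i j h /is_lastP h1 /is_lastP h2; apply/val_inj/eqP.
by rewrite eqn_leq h1 ?h2 // r2.
Qed.
End Classes.

(** * Deleting an element *)

Lemma sum_bij (R : nmodType) (A B : finType) (h : A -> B) (g : B -> A)
    (P : pred B) (Q : pred A) (F : B -> R) :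
    (forall a, Q a -> P (h a) /\ g (h a) = a) ->
    (forall b, P b -> Q (g b) /\ h (g b) = b) ->
  \sum_(b | P b) F b = \sum_(a | Q a) F (h a).
Proof.
move=> hP gP; rewrite (reindex_onto h g) => [|b /gP []//].
apply: eq_bigl => a; apply/andP/idP => [[/gP [] + _ /eqP <-//]|/hP [-> ->]].
by rewrite eqxx.
Qed.

(** Weak monotonicity is enough: if [f] merges two neighbours of a crossing, reflexivity or
    transitivity concludes. This covers both deletion ([lift]) and duplication ([contract]). *)
Lemma ncrel_mxsub m n (f : 'I_m -> 'I_n) (r : 'M[bool]_n) :
    (forall a b : 'I_m, (a < b)%N -> (f a <= f b)%N) ->
  ncrel r -> ncrel (mxsub f f r).
Proof.
move=> fm /ncrelP[r1 r2 r3 r4]; apply/ncrelP; split.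
- by move=> a; rewrite mxE.
- by move=> a b; rewrite !mxE r2.
- by move=> b a c; rewrite !mxE; apply: r3.
move=> a b c e ab bc ce; rewrite !mxE => h1 h2.
have [/val_inj -> //|nab] := eqVneq (val (f a)) (val (f b)).
have [/val_inj -> //|nbc] := eqVneq (val (f b)) (val (f c)).
have [e1|nce] := eqVneq (val (f c)) (val (f e)).
  by apply: (r3 (f c)) => //; rewrite (val_inj e1) r2.
by apply: (r4 _ _ (f c) (f e)); rewrite // ltn_neqAle ?nab ?nbc ?nce fm.
Qed.

Lemma ltn_lift n (i : 'I_n.+1) (a b : 'I_n) : (lift i a < lift i b)%N = (a < b)%N.
Proof. by rewrite !ltnNge leq_bump2. Qed.

Definition add_singleton d (i : 'I_d.+1) (r : 'M[bool]_d) : 'M[bool]_d.+1 :=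
  \matrix_(a, b) match unlift i a, unlift i b with
                 | Some a', Some b' => r a' b'
                 | None, None => true
                 | _, _ => false
                 end.

Section AddSingleton.
Variables (d : nat) (i : 'I_d.+1) (r : 'M[bool]_d).
Local Notation r' := (add_singleton i r).

Lemma add_singleton_ll a b : r' (lift i a) (lift i b) = r a b.
Proof. by rewrite mxE !liftK. Qed.
Lemma add_singleton_il b : r' i (lift i b) = false.
Proof. by rewrite mxE liftK unlift_none. Qed.
Lemma add_singleton_li b : r' (lift i b) i = false.
Proof. by rewrite mxE liftK unlift_none. Qed.
Lemma add_singleton_ii : r' i i.
Proof. by rewrite mxE unlift_none. Qed.
Let rE := (add_singleton_ll, add_singleton_il, add_singleton_li, add_singleton_ii).

Lemma add_singletonK : mxsub (lift i) (lift i) r' = r.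
Proof. by apply/matrixP => a b; rewrite mxE rE. Qed.

Lemma ncrel_add_singleton : ncrel r -> ncrel r'.
Proof.
case/ncrelP=> r1 r2 r3 r4; apply/ncrelP; split.
- by move=> a; case: (unliftP i a) => [a'|] ->; rewrite rE.
- by move=> a b; case: (unliftP i a) => [a'|] ->; case: (unliftP i b) => [b'|] ->;
    rewrite ?rE.
- move=> b a c; case: (unliftP i a) => [a'|] ->; case: (unliftP i b) => [b'|] ->;
    case: (unliftP i c) => [c'|] ->; rewrite ?rE //; exact: r3.
move=> a b c e; case: (unliftP i a) => [a'|] ->; case: (unliftP i b) => [b'|] ->;
  case: (unliftP i c) => [c'|] ->; case: (unliftP i e) => [e'|] ->;
  rewrite ?rE ?ltn_lift //; try exact: r4; try lia.
Qed.

Lemma sing_add_singleton : sing r' i.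
Proof. by apply/singP => j; case: (unliftP i j) => [j'|] ->; rewrite ?rE. Qed.

Lemma sing_add_singleton_lift a : sing r' (lift i a) = sing r a.
Proof.
apply/singP/singP => h j.
  by move=> raj; apply: (@lift_inj _ i); apply: h; rewrite rE.
by case: (unliftP i j) => [j'|] ->; rewrite ?rE // => /h ->.
Qed.

Lemma is_first_add_singleton_lift a : is_first r' (lift i a) = is_first r a.
Proof.
apply/is_firstP/is_firstP => h j.
  by move=> raj; have := h (lift i j); rewrite rE leq_bump2; apply.
by case: (unliftP i j) => [j'|] ->; rewrite ?rE // => /h; rewrite leq_bump2.
Qed.

Lemma nbig_add_singleton : nbig r' = nbig r.
Proof.
rewrite /nbig (bigD1_ord i) //= sing_add_singleton andbF add0n.
by apply: eq_bigr => a _; rewrite sing_add_singleton_lift is_first_add_singleton_lift.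
Qed.
End AddSingleton.

Lemma add_singleton_mxsub d (i : 'I_d.+1) (r : 'M[bool]_d.+1) :
  ncrel r -> sing r i -> add_singleton i (mxsub (lift i) (lift i) r) = r.
Proof.
case/ncrelP=> r1 r2 _ _ /singP h; apply/matrixP => a b.
have hn c : r i (lift i c) = false.
  by apply/negP => /h /eqP; rewrite eq_sym (negPf (neq_lift _ _)).
case: (unliftP i a) => [a'|] ->; case: (unliftP i b) => [b'|] ->.
- by rewrite add_singleton_ll mxE.
- by rewrite add_singleton_li r2 hn.
- by rewrite add_singleton_il hn.
- by rewrite add_singleton_ii r1.
Qed.

Lemma sum_singleton (R : nmodType) d (i : 'I_d.+1) (F : 'M[bool]_d.+1 -> R) :
  \sum_(r | ncrel r && sing r i) F r = \sum_(r | ncrel r) F (add_singleton i r).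
Proof.
apply: (sum_bij (g := mxsub (lift i) (lift i))) => [r h|r /andP[h1 h2]].
  by rewrite ncrel_add_singleton ?sing_add_singleton ?add_singletonK.
split; last exact: add_singleton_mxsub.
by apply: ncrel_mxsub => // a b; rewrite leq_bump2; apply: ltnW.
Qed.

(* Deletes i, which is identified with j; inverse images under it make i a twin of j. *)
Definition contract d (i : 'I_d.+1) (j : 'I_d) (a : 'I_d.+1) : 'I_d := odflt j (unlift i a).

Definition add_twin d (i : 'I_d.+1) (j : 'I_d) (r : 'M[bool]_d) : 'M[bool]_d.+1 :=
  mxsub (contract i j) (contract i j) r.

Section AddTwin.
Variables (d : nat) (i : 'I_d.+1) (j : 'I_d) (r : 'M[bool]_d).
Hypothesis hr : ncrel r.
Local Notation r' := (add_twin i j r).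

Lemma add_twinE a b : r' a b = r (contract i j a) (contract i j b).
Proof. by rewrite mxE. Qed.
Lemma add_twin_ll a b : r' (lift i a) (lift i b) = r a b.
Proof. by rewrite mxE /contract !liftK. Qed.
Lemma add_twin_il b : r' i (lift i b) = r j b.
Proof. by rewrite mxE /contract liftK unlift_none. Qed.
Lemma add_twin_li b : r' (lift i b) i = r b j.
Proof. by rewrite mxE /contract liftK unlift_none. Qed.
Let rE := (add_twin_ll, add_twin_il, add_twin_li).

Lemma add_twinK : mxsub (lift i) (lift i) r' = r.
Proof. by apply/matrixP => a b; rewrite mxE rE. Qed.

Lemma add_twin_ij : r' i (lift i j).
Proof. by rewrite rE; case/ncrelP: hr. Qed.

Lemma sing_add_twin : sing r' i = false.
Proof.
by apply/singP => /(_ _ add_twin_ij)/eqP; rewrite eq_sym (negPf (neq_lift _ _)).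
Qed.

Lemma sing_add_twin_lift a : sing r' (lift i a) = sing r a && (a != j).
Proof.
case/ncrelP: hr => r1 r2 _ _.
apply/singP/andP => [h|[/singP h ne] b].
  split; first by apply/singP => b rab; apply: (@lift_inj _ i); apply: h; rewrite rE.
  apply/eqP => e; move: (h i); rewrite rE e r1 => /(_ isT)/eqP.
  by rewrite (negPf (neq_lift _ _)).
case: (unliftP i b) => [b'|] ->; rewrite rE => /h; first by move->.
by move=> e; rewrite e eqxx in ne.
Qed.

Lemma is_first_add_twin_lift a :
  i = ord_max -> is_first r' (lift i a) = is_first r a.
Proof.
move=> iM; apply/is_firstP/is_firstP => h b.
  by move=> rab; have := h (lift i b); rewrite rE leq_bump2; apply.
case: (unliftP i b) => [b'|] ->; rewrite rE; first by move=> /h; rewrite leq_bump2.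
by rewrite iM lift_max => _; apply: ltnW.
Qed.

Lemma is_last_add_twin_lift a :
  (i < lift i j)%N -> is_last r' (lift i a) = is_last r a.
Proof.
move=> ij; apply/is_lastP/is_lastP => h b.
  by move=> rab; have := h (lift i b); rewrite rE leq_bump2; apply.
case: (unliftP i b) => [b'|] ->; rewrite rE => /h; first by rewrite leq_bump2.
by move=> ja; apply: (leq_trans (ltnW ij)); rewrite leq_bump2.
Qed.

(** A twin turns a singleton [j] into a big block represented by [j], because singletons satisfy
    [P]; this is the extra [sing r j]. *)
Lemma sum_twin (P : pred 'I_d) : (forall a, sing r a -> P a) ->
  (\sum_a (P a && ~~ (sing r a && (a != j))))%N =
  (\sum_a (P a && ~~ sing r a) + sing r j)%N.
Proof.
move=> hP; rewrite (bigD1 j) //= [in RHS](bigD1 j) //= addnAC; congr (_ + _)%N.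
  by rewrite eqxx andbF andbT; case: (boolP (sing r j)) => [/hP ->|]; case: (P j).
by apply: eq_bigr => a ->; rewrite andbT.
Qed.

Lemma nbig_add_twin_max : i = ord_max -> nbig r' = (nbig r + sing r j)%N.
Proof.
move=> iM; rewrite /nbig (bigD1_ord i) //=.
have -> : is_first r' i = false.
  apply/is_firstP => /(_ _ add_twin_ij).
  by rewrite leqNgt iM lift_max ltn_ord.
rewrite add0n -sum_twin; last by move=> a /singP h; apply/is_firstP => b /h ->.
by apply: eq_bigr => a _; rewrite sing_add_twin_lift is_first_add_twin_lift.
Qed.

Lemma nbig_add_twin : ncrel r' -> (i < lift i j)%N -> nbig r' = (nbig r + sing r j)%N.
Proof.
move=> hr' ij; rewrite !nbig_last // (bigD1_ord i) //=.
have -> : is_last r' i = false.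
  by apply/is_lastP => /(_ _ add_twin_ij); rewrite leqNgt ij.
rewrite add0n -sum_twin; last by move=> a /singP h; apply/is_lastP => b /h ->.
by apply: eq_bigr => a _; rewrite sing_add_twin_lift is_last_add_twin_lift.
Qed.
End AddTwin.

(** As [i] and [j] have the same value, [lift i j] is the successor of [i]: the twin is inserted
    right before [j], and [contract i j] is weakly increasing. *)
Lemma ncrel_add_twin d (i : 'I_d.+1) (j : 'I_d) (r : 'M[bool]_d) :
  i = j :> nat -> ncrel r -> ncrel (add_twin i j r).
Proof.
move=> ij; apply: ncrel_mxsub => a b ab; rewrite /contract.
case: (unliftP i a) => [a'|] ea; case: (unliftP i b) => [b'|] eb; rewrite /= ?leqnn //;
  by move: ab; rewrite ea eb /= ?ltnn /bump; lia.
Qed.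

(* The last and the first elements are cyclically adjacent, but [contract] is not
   monotone here, so [ncrel_mxsub] does not apply. *)
Lemma ncrel_add_twin_max d (r : 'M[bool]_d.+1) :
  ncrel r -> ncrel (add_twin ord_max ord0 r).
Proof.
move=> hr; case/ncrelP: (hr) => r1 r2 r3 r4; apply/ncrelP; split.
- by move=> a; rewrite mxE.
- by move=> a b; rewrite !mxE r2.
- by move=> b a c; rewrite !mxE; apply: r3.
move=> a b c e; case: (unliftP ord_max e) => [e'|] ee; last first.
  case: (unliftP ord_max c) => [c'|] ->; last by rewrite ee ltnn.
  case: (unliftP ord_max b) => [b'|] ->; last by rewrite lift_max => _; rewrite ltnNge ltnW.
  case: (unliftP ord_max a) => [a'|] ->; last by rewrite lift_max ltnNge ltnW.
  rewrite ee !lift_max => ab bc _; rewrite !(add_twin_ll, add_twin_li) => ac b0.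
  (* The last element stands for [ord0]. If a' > 0, the pairs (0, b') and (a', c') cross in [r], so
     0 and a' are related. *)
  have [a0|a0] := posnP a'.
    by rewrite r2; have -> : a' = ord0 by apply: val_inj.
  rewrite r2; apply: (r3 ord0) => //.
  by apply: (r4 _ _ b' c') => //; rewrite r2.
case: (unliftP ord_max c) => [c'|] ->; last by rewrite ee lift_max => _ _; rewrite ltnNge ltnW.
case: (unliftP ord_max b) => [b'|] ->; last by rewrite lift_max => _; rewrite ltnNge ltnW.
case: (unliftP ord_max a) => [a'|] ->; last by rewrite lift_max ltnNge ltnW.
by rewrite ee !lift_max !add_twin_ll; apply: r4.
Qed.

Lemma sum_twins (R : nmodType) d (i : 'I_d.+1) (j : 'I_d) (F : 'M[bool]_d.+1 -> R) :
    (forall r, ncrel r -> ncrel (add_twin i j r)) ->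
  \sum_(r | ncrel r && r i (lift i j)) F r = \sum_(r | ncrel r) F (add_twin i j r).
Proof.
move=> hij; apply: (sum_bij (g := mxsub (lift i) (lift i))) => [r h|r /andP[h1 h2]].
  by rewrite hij ?add_twin_ij ?add_twinK.
split; first by apply: ncrel_mxsub => // a b; rewrite leq_bump2; apply: ltnW.
case/ncrelP: h1 => r1 r2 r3 _; apply/matrixP => a b.
case: (unliftP i a) => [a'|] ->; case: (unliftP i b) => [b'|] ->;
  rewrite ?(add_twin_ll, add_twin_li, add_twin_il) !mxE /contract ?unlift_none /= ?r1 //.
- by apply/idP/idP => h; [apply: (r3 (lift i j)) | apply: (r3 i)]; rewrite // r2.
- by apply/idP/idP => h; [apply: (r3 (lift i j)) | apply: (r3 i); rewrite // r2].
Qed.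

(** * Recurrences for the weighted sums *)

Lemma ordS_lift d (i : 'I_d.+1) (a : 'I_d) :
  (i <= a)%N -> (a.+1 < d)%N -> ordS (lift i a) = lift i (ordS a).
Proof.
by move=> ia ad; apply: val_inj; rewrite /= /bump !modn_small; lia.
Qed.

(** Later positions shift by one, as does the threshold, and the new element, at position [i.+1],
    stays below it. *)
Lemma wexp_add_singleton d (i : 'I_d.+1) (r : 'M[bool]_d) :
  wexp i.+2 (add_singleton i r) = wexp i.+1 r.
Proof.
rewrite /wexp nbig_add_singleton !(bigD1_ord i (P := xpredT)) //= ltnn !add0n.
congr (_ + _ + _)%N; apply: eq_bigr => a _.
  by rewrite sing_add_singleton_lift /bump; congr (nat_of_bool (_ && _)); lia.
congr nat_of_bool; apply/and3P/and3P => -[h1 h2];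
  have ia : (i <= a)%N by [move: h1; rewrite /bump; lia];
  have ad : (a.+1 < d)%N by [move: h2; rewrite /bump; lia];
  rewrite /anti ordS_lift // add_singleton_ll => h3; split=> //; rewrite /bump; lia.
Qed.

(** If [j] is a singleton of [r], the new big block makes up for the loss of that singleton, which
    is above the threshold. The antisingleton [i] is below it. *)
Lemma wexp_add_twin d (i : 'I_d.+1) (j : 'I_d) (r : 'M[bool]_d) :
  i = j :> nat -> ncrel r -> wexp i.+2 (add_twin i j r) = wexp i.+1 r.
Proof.
move=> ij hr; have hr' := ncrel_add_twin ij hr.
have lij : (i < lift i j)%N by rewrite /= /bump ij leqnn.
rewrite /wexp nbig_add_twin //.
rewrite !(bigD1_ord i (P := xpredT)) //= ltnn !add0n [in RHS](bigD1 j) //= ij leqnn addnA.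
congr (_ + _ + _)%N; last first.
  apply: eq_bigr => a _.
  congr nat_of_bool; apply/and3P/and3P => -[h1 h2];
    have ia : (i <= a)%N by [move: h1; rewrite /bump; lia];
    have ad : (a.+1 < d)%N by [move: h2; rewrite /bump; lia];
    rewrite /anti ordS_lift // add_twin_ll => h3; split=> //; rewrite /bump; lia.
rewrite [LHS](bigD1 j) //= sing_add_twin_lift // eqxx !andbF add0n.
apply: eq_bigr => a aj; rewrite sing_add_twin_lift // aj andbT.
by congr (nat_of_bool (_ && _)); rewrite /bump; lia.
Qed.

(** The new last element is a twin of the first one, so the wrapped antisingleton of [r] becomes an
    unwrapped one, at the next to last position. The wrapped weight thus turns into the unwrapped
    weight of the longer relation. *)
Lemma wexp_add_twin_max d (r : 'M[bool]_d.+1) :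
  ncrel r -> wexp 1 (add_twin ord_max ord0 r) = wexp0 r.
Proof.
move=> hr; rewrite /wexp /wexp0 nbig_add_twin_max //.
rewrite !(bigD1_ord (@ord_max d.+1) (P := xpredT)) //= sing_add_twin // ltnn !add0n.
congr (_ + _)%N; last first.
  apply: eq_bigr => a _; congr nat_of_bool.
  have -> : (bump d.+1 a).+1 = a.+1 by rewrite /bump; have := ltn_ord a; lia.
  rewrite ltnS ltn_ord /= /anti.
  have [ad|] := ltnP a.+1 d.+1.
    have -> : ordS (lift ord_max a) = lift ord_max (ordS a).
      by apply: val_inj; rewrite /= /bump !modn_small; have := ltn_ord a; lia.
    by rewrite add_twin_ll.
  move=> ad; have e : a = d :> nat by have := ltn_ord a; lia.
  have -> : ordS (lift ord_max a) = ord_max.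
    by apply: val_inj; rewrite /= /bump !modn_small; lia.
  have -> : ordS a = ord0 by apply: val_inj; rewrite /= e modnn.
  by rewrite add_twin_li.
rewrite (bigD1 ord0) //= [in RHS](bigD1 ord0) //= sing_add_twin_lift // eqxx andbF.
rewrite add0n addnA; congr (_ + _)%N.
by apply: eq_bigr => a aj; rewrite sing_add_twin_lift // aj andbT.
Qed.

Lemma wexp_step d (i : 'I_d) (r : 'M[bool]_d) :
  wexp i.+1 r = (wexp i.+2 r + (sing r i + ((i.+1 < d) && anti r i)))%N.
Proof.
have D1 (f : 'I_d -> nat) : (\sum_a f a = f i + \sum_(a | a != i) f a)%N by rewrite (bigD1 i).
rewrite /wexp !D1.
rewrite leqnn ltnn /= !add0n.
have h (a : 'I_d) : a != i -> (i.+1 <= a.+1)%N = (i.+2 <= a.+1)%N.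
  by move=> ai; rewrite !ltnS leq_eqVlt eq_sym (inj_eq val_inj) (negPf ai).
under eq_bigr => a ai do rewrite (h a ai).
under [X in (_ + _ + (_ + X))%N = _]eq_bigr => a ai do rewrite (h a ai).
lia.
Qed.

Lemma wexp0E d (r : 'M[bool]_d.+1) : wexp0 r = (wexp 1 r + anti r ord_max)%N.
Proof.
rewrite /wexp0 /wexp -[RHS]addnA; congr (_ + _ + _)%N.
rewrite (bigD1 ord_max) //= [in RHS](bigD1 ord_max) //= ltnn add0n addnC.
congr (_ + _)%N; apply: eq_bigr => a am; congr nat_of_bool.
by rewrite ltnS ltn_neqAle -(inj_eq val_inj) in am * ; rewrite am -ltnS ltn_ord.
Qed.

Definition ncsum d k : {poly rat} := \sum_(r : 'M[bool]_d | ncrel r) 'X^(wexp k r).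
Definition ncsum0 d : {poly rat} := \sum_(r : 'M[bool]_d | ncrel r) 'X^(wexp0 r).

(** For a boolean b, x^b = 1 + t b. *)
Lemma sumX_bool (I : finType) (P b : pred I) (e : I -> nat) :
  \sum_(r | P r) 'X^(e r + b r) =
    \sum_(r | P r) 'X^(e r) + t * \sum_(r | P r && b r) 'X^(e r).
Proof.
rewrite [X in t * X]big_mkcondr /= mulr_sumr -big_split /=; apply: eq_bigr => r _.
by case: (b r); rewrite ?addn1 ?addn0 ?exprS ?mulr0 ?addr0 //; ring.
Qed.

Lemma ncsum_rec d k : (0 < k <= d)%N ->
  ncsum d.+1 k = ncsum d.+1 k.+1 + 2%:R * t * ncsum d k.
Proof.
case: k => // k; case/andP=> _ kd; rewrite {1}/ncsum.
have kd1 : (k < d.+1)%N by exact: ltnW.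
(* The same position before and after the deletion: [i] is deleted, and [j] is its former
   successor. *)
pose i := Ordinal kd1; pose j := Ordinal kd.
have si : ordS i = lift i j by apply: val_inj; rewrite /= /bump leqnn modn_small.
under eq_bigr => r _ do rewrite (wexp_step i) ltnS kd addnA.
rewrite (sumX_bool _ (fun r : 'M_d.+1 => anti r i)).
rewrite (sumX_bool _ (fun r : 'M_d.+1 => sing r i)) -/(ncsum _ _).
rewrite sum_singleton (eq_bigr (fun r => 'X^(wexp k.+1 r))); last first.
  by move=> r _; rewrite -[k]/(nat_of_ord i) wexp_add_singleton.
have -> : \sum_(r : 'M_d.+1 | ncrel r && anti r i) 'X^(wexp k.+2 r + sing r i) = ncsum d k.+1.
  (* Here [i] is not the last element, so [ordS i] differs from [i] and an antisingleton is not a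
     singleton. *)
  rewrite (eq_bigr (fun r => 'X^(wexp i.+2 r))); last first.
    move=> r /andP[_ h]; congr 'X^ _; case: (boolP (sing r i)) => /=; last by rewrite addn0.
    move/singP => /(_ _ h)/(congr1 val) /=.
    by rewrite modn_small //=; lia.
  rewrite /anti si (@sum_twins _ _ i j); last by move=> r; apply: ncrel_add_twin.
  by apply: eq_bigr => r hr; rewrite wexp_add_twin.
rewrite -/(ncsum _ _); ring.
Qed.

(** For the last element, the antisingleton is the wrapped one, which has no weight here; only the
    singleton term remains, hence t and not 2t. *)
Lemma ncsum_diag d : ncsum d.+1 d.+1 = ncsum d.+1 d.+2 + t * ncsum d d.+1.
Proof.
rewrite {1}/ncsum; pose i := @ord_max d.
under eq_bigr => r _ do rewrite (wexp_step i) ltnn addn0.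
rewrite (sumX_bool _ (fun r : 'M_d.+1 => sing r i)) sum_singleton; congr (_ + t * _).
by apply: eq_bigr => r _; rewrite (wexp_add_singleton i).
Qed.

(** The size is at least two, so that the last element and the first are distinct and can be
    twins. *)
Lemma ncsum0_rec d : ncsum0 d.+2 = ncsum d.+2 1 + t * ncsum0 d.+1.
Proof.
rewrite {1}/ncsum0; under eq_bigr => r _ do rewrite wexp0E.
rewrite (sumX_bool _ (fun r : 'M_d.+2 => anti r ord_max)); congr (_ + t * _).
have e : ordS (@ord_max d.+1) = lift ord_max ord0 by apply: val_inj; rewrite /= modnn.
rewrite /anti e sum_twins; last exact: ncrel_add_twin_max.
by apply: eq_bigr => r hr; rewrite wexp_add_twin_max.
Qed.

Lemma wexp_nbig d (r : 'M[bool]_d) : wexp d.+1 r = nbig r.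
Proof.
rewrite /wexp !big1 ?addn0 // => i _; by rewrite ltnNge ltn_ord.
Qed.

(** * Splitting at the predecessor of the last element *)

Definition dsum m n (r1 : 'M[bool]_m) (r2 : 'M[bool]_n) : 'M[bool]_(m + n) :=
  \matrix_(a, b) match split a, split b with
                 | inl a', inl b' => r1 a' b'
                 | inr a', inr b' => r2 a' b'
                 | _, _ => false
                 end.

Section DirectSum.
Variables (m n : nat) (r1 : 'M[bool]_m) (r2 : 'M[bool]_n).
Local Notation r := (dsum r1 r2).

Lemma dsum_ll a b : r (lshift n a) (lshift n b) = r1 a b.
Proof. by rewrite mxE !(unsplitK (inl _)). Qed.
Lemma dsum_lr a b : r (lshift n a) (rshift m b) = false.
Proof. by rewrite mxE (unsplitK (inl _)) (unsplitK (inr _)). Qed.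
Lemma dsum_rl a b : r (rshift m a) (lshift n b) = false.
Proof. by rewrite mxE (unsplitK (inl _)) (unsplitK (inr _)). Qed.
Lemma dsum_rr a b : r (rshift m a) (rshift m b) = r2 a b.
Proof. by rewrite mxE !(unsplitK (inr _)). Qed.
Definition dsumE := (dsum_ll, dsum_lr, dsum_rl, dsum_rr).

Lemma ncrel_dsum : ncrel r1 -> ncrel r2 -> ncrel r.
Proof.
case/ncrelP=> h1 h2 h3 h4 /ncrelP[k1 k2 k3 k4]; apply/ncrelP; split.
- by move=> a; case: (split_ordP a) => a' ->; rewrite dsumE.
- by move=> a b; case: (split_ordP a) => a' ->; case: (split_ordP b) => b' ->;
    rewrite !dsumE.
- move=> b a c; case: (split_ordP a) => a' ->; case: (split_ordP b) => b' ->;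
    case: (split_ordP c) => c' ->; rewrite !dsumE //; [exact: h3|exact: k3].
move=> a b c e; case: (split_ordP a) => a' ->; case: (split_ordP b) => b' ->;
  case: (split_ordP c) => c' ->; case: (split_ordP e) => e' ->; rewrite !dsumE //=;
  first [exact: h4 | by rewrite !ltn_add2l; apply: k4 |
         by have := ltn_ord a'; have := ltn_ord b'; have := ltn_ord c'; lia].
Qed.

Lemma sing_dsum_l a : sing r (lshift n a) = sing r1 a.
Proof.
apply/singP/singP => h j.
  by move=> raj; apply: (@lshift_inj _ n); apply: h; rewrite dsumE.
by case: (split_ordP j) => j' ->; rewrite dsumE // => /h ->.
Qed.

Lemma sing_dsum_r a : sing r (rshift m a) = sing r2 a.
Proof.
apply/singP/singP => h j.
  by move=> raj; apply: (@rshift_inj m); apply: h; rewrite dsumE.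
by case: (split_ordP j) => j' ->; rewrite dsumE // => /h ->.
Qed.

Lemma is_first_dsum_l a : is_first r (lshift n a) = is_first r1 a.
Proof.
apply/is_firstP/is_firstP => h j.
  by have := h (lshift n j); rewrite dsumE.
by case: (split_ordP j) => j' ->; rewrite dsumE // => /h.
Qed.

Lemma is_first_dsum_r a : is_first r (rshift m a) = is_first r2 a.
Proof.
apply/is_firstP/is_firstP => h j.
  by have := h (rshift m j); rewrite dsumE /= leq_add2l.
by case: (split_ordP j) => j' ->; rewrite dsumE // => /h; rewrite /= leq_add2l.
Qed.

Lemma nbig_dsum : nbig r = (nbig r1 + nbig r2)%N.
Proof.
rewrite /nbig big_split_ord /=; congr (_ + _)%N; apply: eq_bigr => a _.
  by rewrite sing_dsum_l is_first_dsum_l.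
by rewrite sing_dsum_r is_first_dsum_r.
Qed.
End DirectSum.

Definition is_prev d (r : 'M[bool]_d.+1) (v : 'I_d) : bool :=
  r (lift ord_max v) ord_max && [forall a : 'I_d, (v < a)%N ==> ~~ r (lift ord_max a) ord_max].

(** The last element joins the block of the last point of [rr.1], which becomes its predecessor;
    [rr.2] fills the gap between the two. *)
Definition glue p q (rr : 'M[bool]_p.+1 * 'M[bool]_q) : 'M[bool]_((p.+1 + q).+1) :=
  add_twin ord_max (lshift q ord_max) (dsum rr.1 rr.2).

Definition unglue p q (r : 'M[bool]_((p.+1 + q).+1)) : 'M[bool]_p.+1 * 'M[bool]_q :=
  (mxsub (lift ord_max \o lshift q) (lift ord_max \o lshift q) r,
   mxsub (lift ord_max \o @rshift p.+1 q) (lift ord_max \o @rshift p.+1 q) r).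

Section Glue.
Variables (p q : nat).
Local Notation M := (@ord_max (p.+1 + q)).

Lemma glueK : cancel (@glue p q) (@unglue p q).
Proof.
case=> r1 r2; congr pair; apply/matrixP => a b; by rewrite mxE /= add_twin_ll dsumE.
Qed.

Lemma ncrel_glue rr : ncrel rr.1 -> ncrel rr.2 -> ncrel (@glue p q rr).
Proof.
case: rr => r1 r2 /= h1 h2; have hr := ncrel_dsum h1 h2.
case/ncrelP: (hr) => s1 s2 s3 s4; rewrite /glue /=; apply/ncrelP; split.
- by move=> a; rewrite add_twinE.
- by move=> a b; rewrite !add_twinE s2.
- by move=> b a c; rewrite !add_twinE; apply: s3.
move=> a b c e; case: (unliftP M e) => [e'|] ->; last first.
  case: (unliftP M c) => [c'|] ->; last by rewrite ltnn.
  case: (unliftP M b) => [b'|] ->; last by rewrite lift_max => _; rewrite ltnNge ltnW.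
  case: (unliftP M a) => [a'|] ->; last by rewrite lift_max ltnNge ltnW.
  rewrite !lift_max !(add_twin_ll, add_twin_li) /=.
  case: (split_ordP a') => a1 ->; case: (split_ordP b') => b1 ->;
    case: (split_ordP c') => c1 ->; rewrite !dsumE //=.
    case/ncrelP: h1 => u1 u2 u3 u4 ab bc _ ac bm.
    (* The last element stands for the point p of [r1]. If [c1] is that point, no crossing is left
       and transitivity concludes. *)
    have [cm|cm] := ltnP c1 p; first exact: (u4 _ _ c1 ord_max).
    have -> : r1 a1 b1 = r1 a1 c1; last by [].
    have -> : c1 = ord_max.
      by apply: val_inj => /=; have := ltn_ord c1; lia.
    by apply/idP/idP => h; [apply: (u3 b1)|apply: (u3 ord_max); rewrite // u2].
  by have := ltn_ord b1; lia.
case: (unliftP M c) => [c'|] ->; last by rewrite lift_max => _ _; rewrite ltnNge ltnW.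
case: (unliftP M b) => [b'|] ->; last by rewrite lift_max => _; rewrite ltnNge ltnW.
case: (unliftP M a) => [a'|] ->; last by rewrite lift_max ltnNge ltnW.
by rewrite !lift_max !add_twin_ll; apply: s4.
Qed.

Lemma is_prev_glue rr : ncrel rr.1 -> is_prev (@glue p q rr) (lshift q ord_max).
Proof.
case: rr => r1 r2 /= /ncrelP[h1 _ _ _]; rewrite /is_prev /glue /= add_twin_li dsumE h1 /=.
apply/forallP => a; apply/implyP; rewrite add_twin_li.
by case: (split_ordP a) => a' ->; rewrite /= dsumE //; have := ltn_ord a'; lia.
Qed.

Lemma unglueK (r : 'M[bool]_((p.+1 + q).+1)) :
  ncrel r -> is_prev r (lshift q ord_max) -> glue (unglue r) = r.
Proof.
case/ncrelP=> r1 r2 r3 r4 /andP[rp /forallP rm].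
have Mr b : r M (lift M (rshift p.+1 b)) = false.
  by rewrite r2; apply: negbTE; apply: (implyP (rm _)) => /=; lia.
(* If a point a < p were related to a point of the gap, this pair would cross the pair formed by p
   and the last element; the gap point would then be related to the last element, against the choice
   of p as predecessor. For a = p this is immediate. *)
have lr a b : r (lift M (lshift q a)) (lift M (rshift p.+1 b)) = false.
  apply/negP => h; have /negP := Mr b; apply.
  have [ap|ap] := ltnP a p.
    apply: (r3 (lift M (lshift q a))) => //; rewrite r2.
    apply: (r3 (lift M (lshift q ord_max))) => //.
    by apply: (r4 _ _ (lift M (rshift p.+1 b)) M) => //;
      rewrite !lift_max /=; have := ltn_ord a; have := ltn_ord b; lia.
  have e : a = ord_max by apply: val_inj => /=; have := ltn_ord a; lia.
  by rewrite e in h; apply: r3 h; rewrite r2.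
have Ml a : r M (lift M (lshift q a)) = r (lift M (lshift q ord_max)) (lift M (lshift q a)).
  by apply/idP/idP => h; [apply: (r3 M) | apply: r3 h; rewrite r2].
apply/matrixP => a b; rewrite /glue.
case: (unliftP M a) => [a'|] ->; case: (unliftP M b) => [b'|] ->.
- rewrite add_twin_ll; case: (split_ordP a') => a1 ->; case: (split_ordP b') => b1 ->.
  + by rewrite dsumE mxE.
  + by rewrite dsumE lr.
  + by rewrite dsumE r2 lr.
  + by rewrite dsumE mxE.
- rewrite add_twin_li r2; case: (split_ordP a') => a1 ->.
  + by rewrite dsumE mxE Ml r2.
  + by rewrite dsumE Mr.
- rewrite add_twin_il; case: (split_ordP b') => b1 ->.
  + by rewrite dsumE mxE Ml.
  + by rewrite dsumE Mr.
- by rewrite add_twinE /contract unlift_none /= dsumE mxE !r1.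
Qed.

Lemma sum_glue (R : nmodType) (F : 'M[bool]_((p.+1 + q).+1) -> R) :
  \sum_(r | ncrel r && is_prev r (lshift q ord_max)) F r =
  \sum_(r1 | ncrel r1) \sum_(r2 | ncrel r2) F (glue (r1, r2)).
Proof.
rewrite pair_big /=.
rewrite (sum_bij (h := @glue p q) (g := @unglue p q)
  (Q := fun rr => ncrel rr.1 && ncrel rr.2)).
- by apply: eq_bigr => -[].
- by move=> rr /andP[h1 h2]; rewrite ncrel_glue // is_prev_glue // glueK.
move=> r /andP[h1 h2]; split; last exact: unglueK.
by apply/andP; split; apply: ncrel_mxsub => // a b /=; rewrite leq_bump2 /=; lia.
Qed.

(** Attaching the last element creates a big block exactly when its predecessor was a singleton. *)
Lemma nbig_glue rr : ncrel rr.1 -> ncrel rr.2 ->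
  nbig (@glue p q rr) = (nbig rr.1 + sing rr.1 ord_max + nbig rr.2)%N.
Proof.
move=> h1 h2; rewrite nbig_add_twin_max //; last exact: ncrel_dsum.
by rewrite nbig_dsum sing_dsum_l addnAC.
Qed.
End Glue.

Definition ncbig d : {poly rat} := \sum_(r : 'M[bool]_d | ncrel r) 'X^(nbig r).

Lemma ncsum_ncbig d : ncsum d d.+1 = ncbig d.
Proof. by apply: eq_bigr => r _; rewrite wexp_nbig. Qed.

(** The term [t * ncbig p] comes from the left parts whose last point is a singleton, deleted in
    turn. Stating the size as an equation avoids casts of ['I_d] when q is [d - v.+1]. *)
Lemma sum_is_prev p q d (v : 'I_d) : d = (p.+1 + q)%N -> v = p :> nat ->
  \sum_(r | ncrel r && is_prev r v) 'X^(nbig r) =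
  (ncbig p.+1 + t * ncbig p) * ncbig q.
Proof.
move=> e; subst d => vp.
have -> : v = lshift q ord_max by apply: val_inj.
rewrite sum_glue.
transitivity ((\sum_(r1 : 'M[bool]_p.+1 | ncrel r1) 'X^(nbig r1 + sing r1 ord_max)) * ncbig q).
  rewrite mulr_suml; apply: eq_bigr => r1 h1; rewrite mulr_sumr; apply: eq_bigr => r2 h2.
  by rewrite nbig_glue // exprD.
congr (_ * _); rewrite (sumX_bool _ (fun r1 : 'M_p.+1 => sing r1 ord_max)); congr (_ + t * _).
by rewrite sum_singleton; apply: eq_bigr => r _; rewrite nbig_add_singleton.
Qed.

Lemma is_prev_or_sing d (r : 'M[bool]_d.+1) : ncrel r -> ~~ sing r ord_max ->
  exists v, is_prev r v.
Proof.
case/ncrelP=> r1 r2 r3 _ /forallPn[j]; rewrite negb_imply => /andP[rj jM].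
case: (unliftP ord_max j) jM rj => [j'|] ->; last by rewrite eqxx.
rewrite r2 => _ rj; pose P := [pred a | r (lift ord_max a) ord_max].
have Pj : P j' by [].
case: (arg_maxnP (fun j : 'I_d => j : nat) Pj) => v hv vmax.
exists v; rewrite /is_prev (hv : r _ _) /=; apply/forallP => a; apply/implyP => va.
by apply/negP => /vmax /=; rewrite leqNgt va.
Qed.

(** The isolated [ncbig d] collects the relations whose last element is a singleton; it matches the
    term i = 0 of the first sum in [gL_rec]. The others are sorted by the unique predecessor v of
    the last element. *)
Lemma ncbig_rec d : ncbig d.+1 =
  ncbig d + \sum_(v < d) (ncbig v.+1 + t * ncbig v) * ncbig (d - v.+1).
Proof.
have -> : ncbig d = \sum_(r : 'M_d.+1 | ncrel r && sing r ord_max) 'X^(nbig r).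
  by rewrite sum_singleton; apply: eq_bigr => r _; rewrite nbig_add_singleton.
rewrite {1}/ncbig (bigID (fun r : 'M_d.+1 => sing r ord_max)) /=; congr (_ + _).
have uniq_prev (r : 'M_d.+1) v w : is_prev r v -> is_prev r w -> (w <= v)%N.
  move=> /andP[_ /forallP hv] /andP[hw _]; rewrite leqNgt; apply/negP => vw.
  by have := hv w; rewrite vw hw.
transitivity (\sum_(r : 'M_d.+1 | ncrel r && ~~ sing r ord_max)
                \sum_(v | is_prev r v) 'X^(nbig r) : {poly rat}).
  apply: eq_bigr => r /andP[h1 h2]; have [v hv] := is_prev_or_sing h1 h2.
  rewrite (big_pred1 v) // => w; apply/idP/eqP => [hw|->//].
  by apply/val_inj/anti_leq; rewrite !(uniq_prev r).
rewrite (exchange_big_dep xpredT) //=; apply: eq_bigr => v _.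
rewrite -(@sum_is_prev v (d - v.+1) d v) //; last by have := ltn_ord v; lia.
apply: eq_bigl => r; rewrite -andbA; case: (boolP (ncrel r)) => //= hr.
case: (boolP (is_prev r v)) => [/andP[hv _]|]; last by rewrite andbF.
rewrite andbT; apply/singP => h; case/ncrelP: hr => _ r2 _ _.
move: (h (lift ord_max v)); rewrite r2 hv => /(_ isT)/eqP.
by rewrite eq_sym (negPf (neq_lift _ _)).
Qed.

Lemma ncbig0 : ncbig 0 = 1.
Proof.
rewrite /ncbig (big_pred1 (\matrix_(i, j) true)) => [|r].
  by rewrite /nbig big_ord0 expr0.
have -> : r = \matrix_(i, j) true by apply/matrixP => -[].
by rewrite /= eqxx; apply/ncrelP; split=> -[].
Qed.

(** * Partitions and relations *)

Definition rel_of_partition d (pi : {set {set 'I_d}}) : 'M[bool]_d :=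
  \matrix_(i, j) (j \in pblock pi i).

Lemma classesE d (r : 'M[bool]_d) : classes r = equivalence_partition r setT.
Proof.
rewrite /classes /equivalence_partition; apply/setP => B.
apply/imsetP/imsetP => -[i _ ->]; exists i => //; apply/setP => j; by rewrite !inE.
Qed.

Section ClassesNC.
Variables (d : nat) (r : 'M[bool]_d).
Hypothesis hr : ncrel r.

Let eqr : {in [set: 'I_d] & &, equivalence_rel r}.
Proof.
case/ncrelP: hr => r1 r2 r3 _ x y z _ _ _; split=> // h.
by apply/idP/idP => h'; [apply: (r3 x) => //; rewrite r2 | apply: (r3 y)].
Qed.

Lemma mem_classes B i : B \in classes r -> i \in B -> B = cls r i.
Proof. by case/imsetP => j _ ->; rewrite inE => /(cls_eq hr). Qed.

Lemma classes_NC : classes r \in NC d.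
Proof.
case/ncrelP: (hr) => r1 r2 r3 r4.
rewrite inE classesE equivalence_partitionP //= -classesE.
apply/forall_inP => B hB; apply/forall_inP => B' hB'.
apply/forallP => a; apply/forallP => b; apply/forallP => c; apply/forallP => e.
apply/implyP => /and5P[ab bc ce aB /and3P[cB bB eB]].
rewrite (mem_classes hB aB) (mem_classes hB' bB); apply/eqP/cls_eq => //.
apply: (r4 _ _ c e) => //.
  by move: cB; rewrite (mem_classes hB aB) inE.
by move: eB; rewrite (mem_classes hB' bB) inE.
Qed.

Lemma classesK : rel_of_partition (classes r) = r.
Proof.
by apply/matrixP => i j; rewrite mxE classesE pblock_equivalence_partition ?inE.
Qed.

Lemma singleton_classes i : singleton (classes r) i = sing r i.
Proof.
case/ncrelP: (hr) => r1 _ _ _.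
apply/idP/singP => [h j|h].
  have := mem_classes h (set11 i) => /setP/(_ j); rewrite !inE => <-.
  by move/eqP.
apply/imsetP; exists i => //; apply/setP => j; rewrite !inE.
by apply/eqP/idP => [->|/h].
Qed.

Lemma antisingleton_classes i : antisingleton (classes r) i = anti r i.
Proof.
case/ncrelP: (hr) => r1 _ _ _.
apply/exists_inP/idP => [[B hB /andP[h1 h2]]|h].
  by move: h2; rewrite (mem_classes hB h1) inE.
by exists (cls r i); [apply: imset_f | rewrite !inE r1].
Qed.
End ClassesNC.

Lemma rel_of_partitionP d (pi : {set {set 'I_d}}) : pi \in NC d ->
  ncrel (rel_of_partition pi) /\ classes (rel_of_partition pi) = pi.
Proof.
rewrite inE => /andP[hp nc]; have /and3P[/eqP cov tI _] := hp.
have inp i : i \in pblock pi i by rewrite mem_pblock cov inE.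
have inpi i : pblock pi i \in pi by rewrite pblock_mem // cov inE.
have E i j : (j \in pblock pi i) = (pblock pi i == pblock pi j).
  by rewrite eq_pblock // cov inE.
split.
  apply/ncrelP; split.
  - by move=> a; rewrite mxE.
  - by move=> a b; rewrite !mxE !E eq_sym.
  - by move=> b a c; rewrite !mxE !E => /eqP ->.
  move=> a b c e ab bc ce; rewrite !mxE => ac be; rewrite E.
  move/forall_inP/(_ _ (inpi a))/forall_inP/(_ _ (inpi b)): nc.
  move/forallP/(_ a)/forallP/(_ b)/forallP/(_ c)/forallP/(_ e)/implyP; apply.
  by rewrite ab bc ce ac be !inp.
rewrite classesE -[RHS](equivalence_partition_pblock hp).
by apply: eq_imset => x; apply/setP => y; rewrite !inE mxE.
Qed.

Lemma sum_NC (R : nmodType) d (F : {set {set 'I_d}} -> R) :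
  \sum_(pi in NC d) F pi = \sum_(r | ncrel r) F (classes r).
Proof.
apply: (sum_bij (g := @rel_of_partition d)) => [r h|pi /rel_of_partitionP //].
by rewrite classes_NC ?classesK.
Qed.

Lemma card_set_sum (I : finType) (P : pred I) : #|[set i | P i]| = (\sum_i P i)%N.
Proof. by rewrite -sum1dep_card big_mkcond; apply: eq_bigr => i _; case: (P i). Qed.

Lemma wtk_classes d k (r : 'M[bool]_d) : ncrel r -> (0 < k <= d.+1)%N ->
  wtk k (classes r) = 'X^(wexp k r).
Proof.
move=> hr /andP[k0 kd].
rewrite /wtk /wt /wexp /nblock nbigE // !card_set_sum /wt_family eqn0Ngt k0 /=.
congr ('X^(_ + _ + _)); apply: eq_bigr => i _; congr nat_of_bool.
  rewrite /singleton_in singleton_classes // andbC; congr (_ && _).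
  case: ifP => [kd'|/negbT] /=; first by rewrite orbF ltn_ord andbT.
  by have := ltn_ord i; lia.
rewrite /antisingleton_in antisingleton_classes //.
rewrite andbC andbA; congr (_ && _).
(* For i + 1 < d, [ordS i] is the next element and lies in [k, d] along with [i]; at i + 1 = d an
   unwrapped family contributes nothing. *)
case: ifP => hi; case: ifP => kd' /=; rewrite ?orbF ?andbT ?andbF //; last first.
  by have := ltn_ord i; lia.
by rewrite modn_small //; lia.
Qed.

Lemma wtk0_classes d (r : 'M[bool]_d) : ncrel r -> wtk 0 (classes r) = 'X^(wexp0 r).
Proof.
move=> hr; rewrite /wtk /wt /wexp0 /nblock nbigE // !card_set_sum /wt_family /=.
congr ('X^(_ + _ + _)); apply: eq_bigr => i _; congr nat_of_bool.
  by rewrite /singleton_in singleton_classes // andbT.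
by rewrite /antisingleton_in antisingleton_classes //= if_same andbT.
Qed.

Lemma sum_wtk d k : (0 < k <= d.+1)%N -> \sum_(pi in NC d) wtk k pi = ncsum d k.
Proof. by move=> hk; rewrite sum_NC; apply: eq_bigr => r hr; rewrite wtk_classes. Qed.

Lemma sum_wtk0 d : \sum_(pi in NC d) wtk 0 pi = ncsum0 d.
Proof. by rewrite sum_NC; apply: eq_bigr => r hr; rewrite wtk0_classes. Qed.

(** * Comparison of the two sides *)

Lemma gL_ncbig d : gL d = ncbig d.
Proof.
elim/ltn_ind: d => -[|d] IH; first by rewrite gL0 ncbig0.
rewrite gL_rec ncbig_rec big_ord_recl gL0 mul1r subn0 IH // -addrA; congr (_ + _).
rewrite mulr_sumr -big_split /=; apply: eq_bigr => v _; rewrite /bump add1n.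
have vd := ltn_ord v.
have -> : (d.-1 - v = d - v.+1)%N by lia.
by rewrite !IH ?mulrDl ?mulrA //; lia.
Qed.

(** Induction on d and, for fixed d, downwards on k from the diagonal: each recurrence either lowers
    d or raises k. *)
Lemma Q_ncsum d k : (0 < k <= d)%N -> Q d k = 2%:R * ncsum d k.
Proof.
elim: d k => [|d IH] k; first by case: k.
have [m] := ubnP (d.+1 - k); elim: m k => // m IHm k hm /andP[k0 kd].
have [e|kd'] := eqVneq k d.+1.
  by rewrite e Q_diag ncsum_diag !ncsum_ncbig !gL_ncbig.
have hk : (0 < k <= d)%N by lia.
by rewrite Q_rec // ncsum_rec // IHm ?IH //; [ring | lia..].
Qed.

Lemma Q0_ncsum0 d : Q d.+1 0 = ncsum0 d.+1.
Proof.
(* [Q0_rec] gives twice the desired identity, so 2 is cancelled at the end. *)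
have two : 2%:R != 0 :> {poly rat} by rewrite -polyC_natr polyC_eq0 pnatr_eq0.
elim: d => [|d IH].
  (* In size one the only element is its own cyclic successor, so the wrapped antisingleton always
     contributes a factor x. *)
  have -> : ncsum0 1 = 'X * ncsum 1 1.
    rewrite /ncsum mulr_sumr; apply: eq_bigr => r /ncrelP[r1 _ _ _].
    by rewrite wexp0E /anti (ord1 (ordS _)) (ord1 ord_max) r1 addn1 exprS.
  rewrite ncsum_diag !ncsum_ncbig -!gL_ncbig Q0_gLbin gLbinS !gLbin0 gL_rec gL0.
  by rewrite big_ord1 big_ord0 gL0; ring.
by apply: (mulfI two); rewrite Q0_rec // Q_ncsum // ncsum0_rec IH; ring.
Qed.

Theorem theorem4p12 (d k : nat) (hd : (1 <= d)%N) (hk : (k <= d.+1)%N) :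
  Q d k = if (1 <= k <= d)%N then 2%:R * \sum_(pi in NC d) wtk k pi
          else \sum_(pi in NC d) wtk k pi.
Proof.
case: k hk => [|k] hk.
  by rewrite sum_wtk0; case: d hd {hk} => // d _; rewrite Q0_ncsum0.
rewrite sum_wtk //=; case: ifP => [kd|/negbT kd]; first exact: Q_ncsum.
have -> : k.+1 = d.+1 by lia.
by rewrite /Q /= ltnn ncsum_ncbig gL_ncbig.
Qed.
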